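(* Let $S=[0,1]^3$ be the unit cube. Among all admissible orientations of $S$, the drainage time $T(R)$ attains its minimum when one of the cube's space diagonals is vertical, and $$T_{\min}=\frac{8\sqrt[4]{3}}{5K}\left(1+3\sqrt{3}-4\sqrt{2}\right).$$
   Context: For a rotation $R$ of $\mathbb{R}^3$, let $S_R$ be the translate of $R(S)$ lying in $\{z\ge0\}$ and touching the plane $z=0$ (the orifice is at the lowest point of the container). The drainage time is $T(R)=\frac1K\iiint_{S_R} z^{-1/2}\,dV=\frac1K\int_0^H A(h)h^{-1/2}\,dh$, where $K>0$ is a fixed constant, $A(h)$ is the area of the horizontal cross-section at height $h$ and $H$ is the height of $S_R$ (this is the total drainage time under Torricelli's law $A(h)h'=-ka\sqrt{2gh}$, $K=ka\sqrt{2g}$). $T_{\min}$ denotes the minimum of $T(R)$ over all rotations $R$. *)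

(* Defs.v *)
From HB Require Import structures.
From mathcomp Require Import all_boot all_order all_algebra.
From mathcomp Require Import all_classical all_reals all_analysis.
Set Implicit Arguments. Unset Strict Implicit. Unset Printing Implicit Defensive.
Import Order.TTheory GRing.Theory Num.Theory.
Local Open Scope classical_set_scope.
Local Open Scope ring_scope.

Section Defs.
Variable R : realType.

(* Points of R^3 are triples ((x, y), z); the last component is the height. *)
Definition pt3 (x y z : R) : R * R * R := ((x, y), z).
Definition px (p : R * R * R) : R := p.1.1.
Definition py (p : R * R * R) : R := p.1.2.
Definition pz (p : R * R * R) : R := p.2.

Definition leb3 := ((@lebesgue_measure R \x @lebesgue_measure R) \x @lebesgue_measure R)%E.

Definition is_rotation (M : 'M[R]_3) : Prop := M^T *m M = 1%:M /\ \det M = 1.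

Definition mat_apply (M : 'M[R]_3) (p : R * R * R) : R * R * R :=
  let v := \col_(i < 3) [:: px p; py p; pz p]`_i in
  let w := M *m v in
  pt3 (w ord0 ord0) (w (inord 1) ord0) (w (inord 2) ord0).

Definition unit_cube : set (R * R * R) :=
  [set p | (0 <= px p <= 1) /\ (0 <= py p <= 1) /\ (0 <= pz p <= 1)].

Definition low (M : 'M[R]_3) : R := inf [set pz (mat_apply M p) | p in unit_cube].

(* S_R : the (vertical) translate of R(S) lying in {z >= 0} and touching z = 0. *)
Definition S_R (M : 'M[R]_3) : set (R * R * R) :=
  [set pt3 (px (mat_apply M p)) (py (mat_apply M p)) (pz (mat_apply M p) - low M)
  | p in unit_cube].

Definition drain_time (K : R) (M : 'M[R]_3) : \bar R :=
  ((K^-1)%:E * \int[leb3]_(p in S_R M) (powR (pz p) (- (2^-1)))%:E)%E.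

Definition space_diagonals : set (R * R * R) :=
  [set pt3 1 1 1; pt3 (-1) 1 1; pt3 1 (-1) 1; pt3 1 1 (-1)].

Definition diagonal_vertical (M : 'M[R]_3) : Prop :=
  exists2 d, space_diagonals d &
    px (mat_apply M d) = 0 /\ py (mat_apply M d) = 0.

End Defs.

(* Main.v *)
Require Import Defs.
From HB Require Import structures.
From mathcomp Require Import all_boot all_order all_algebra.
From mathcomp Require Import all_classical all_reals all_analysis.
From mathcomp Require Import measurable_realfun ring lra.
Set Implicit Arguments. Unset Strict Implicit. Unset Printing Implicit Defensive.
Import Order.TTheory GRing.Theory Num.Theory.
Import numFieldNormedType.Exports.
Local Open Scope classical_set_scope.
Local Open Scope ring_scope.

(** Let [n] be the third row of the rotation. Rotations preserve Lebesgue measure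
    (a matrix of determinant 1 is a product of transvections, each of which is a
    shear handled by Fubini and translation invariance on the line), and reflecting
    the axes along which [n] is negative turns the drainage time into
    [K^-1 * \int_cube (a x + b y + c z)^(-1/2)] with [(a, b, c) = (|n_0|, |n_1|, |n_2|)]
    of norm 1. This integral is unchanged when [(a, b, c)] is permuted cyclically, so
    by convexity of [t^(-1/2)] it is at least its value at [a = b = c = m], where
    [m] is the mean of [a], [b], [c]. Since [m <= 1 / sqrt 3] and [t^(-1/2)]
    decreases, the minimum is reached at [a = b = c = 1 / sqrt 3], that is, with a
    space diagonal vertical. The value there is an iterated integral. *)

(** * Translations and reflection of the real line *)

Section LebesgueInvariance.
Context {R : realType}.
Local Notation mu := (@lebesgue_measure R).
Local Notation TR := (measurableTypeR R).
Implicit Types (f : TR -> \bar R).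

Lemma measurable_addl (c : R) : measurable_fun setT (+%R c : TR -> TR).
Proof. by apply: (@measurable_funD _ _ R setT (cst c) idfun) => //; exact: measurable_id. Qed.

Definition addl_mfun (c : R) : {mfun TR >-> TR} :=
  HB.pack (+%R c : TR -> TR)
    (isMeasurableFun.Build _ _ _ _ _ (measurable_addl c)).

(** By uniqueness of Lebesgue measure it suffices to compare the two measures on half-open
    intervals, where translation keeps the length. *)
Lemma lebesgue_measure_shift (c : R) (A : set TR) : measurable A ->
  pushforward mu (+%R c : TR -> TR) A = mu A.
Proof.
move=> mA; apply/esym.
apply: (@lebesgue_measure_unique R (pushforward mu (addl_mfun c))) => //=.
move=> _ [[a b]] _ <-.
rewrite /pushforward /=.
have -> : +%R c @^-1` `]a, b] = `](a - c), (b - c)]%classic.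
  by apply/seteqP; split => x /=; rewrite !in_itv/= ltrBlDl lerBrDl.
rewrite !lebesgue_measure_itv/= !lte_fin ltrD2r; case: ifPn => // _.
by rewrite -!EFinB; congr (_%:E); ring.
Qed.

Lemma ge0_integral_shift f (c : R) : measurable_fun setT f ->
  (forall x, 0 <= f x)%E ->
  (\int[mu]_x f (c + x)%R = \int[mu]_x f x)%E.
Proof.
move=> mf f0.
transitivity (\int[pushforward mu (addl_mfun c)]_x f x)%E.
  by rewrite (ge0_integral_pushforward (measurable_addl c)) ?preimage_setT.
by apply: eq_measure_integral => A mA _; exact: lebesgue_measure_shift.
Qed.

Lemma ge0_integralN f : measurable_fun setT f ->
  (forall x, 0 <= f x)%E ->
  (\int[mu]_x f (- x)%R = \int[mu]_x f x)%E.
Proof.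
move=> mf f0.
have mN : measurable_fun setT (-%R : TR -> TR) by exact: oppr_measurable.
transitivity (\int[pushforward mu (-%R : TR -> TR)]_x f x)%E.
  by rewrite (ge0_integral_pushforward mN) ?preimage_setT.
by apply: eq_measure_integral => A mA _; exact: lebesgue_measureN.
Qed.

End LebesgueInvariance.

(* The library's sigma-finite instance on [m1 \x m2] is shadowed by its instance
   for products of subprobabilities, hence the explicit structure. *)
Definition sigma_finite_prod (d1 d2 : measure_display) (T1 : measurableType d1)
    (T2 : measurableType d2) (R : realType)
    (m1 : {sigma_finite_measure set T1 -> \bar R})
    (m2 : {sigma_finite_measure set T2 -> \bar R}) :
    {sigma_finite_measure set (T1 * T2)%type -> \bar R} :=
  HB.pack (m1 \x m2)%E (Measure_isSigmaFinite.Build _ _ _ (m1 \x m2)%E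
    (lebesgue_integral_fubini.product_measure_sigma_finite_subproof m1 m2)).

Lemma ge0_integral_prod3 (d1 d2 d3 : measure_display) (T1 : measurableType d1)
  (T2 : measurableType d2) (T3 : measurableType d3) (R : realType)
  (m1 : {sigma_finite_measure set T1 -> \bar R})
  (m2 : {sigma_finite_measure set T2 -> \bar R})
  (m3 : {sigma_finite_measure set T3 -> \bar R}) (f : T1 * T2 * T3 -> \bar R) :
  measurable_fun setT f -> (forall p, 0 <= f p)%E ->
  (\int[(m1 \x m2) \x m3]_p f p =
   \int[m1]_x \int[m2]_y \int[m3]_z f ((x, y), z))%E.
Proof.
move=> mf f0.
have -> := @fubini_tonelli1 _ _ _ _ _
  (sigma_finite_prod m1 m2) m3 f mf f0.
have -> // := @fubini_tonelli1 _ _ _ _ _ m1 m2 (fubini_F m3 f).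
- exact: measurable_fun_fubini_tonelli_F.
- by move=> p; apply: integral_ge0 => z _.
Qed.

(** * Volume-preserving maps of space *)

Section MeasurePreservingMaps.
Context {R : realType}.
Local Notation mu := (@lebesgue_measure R).
Local Notation TR := (measurableTypeR R).
Local Notation T3 := (TR * TR * TR)%type.

(** Invariance is phrased through integrals of nonnegative functions: in this form it composes at
    once and can be checked on iterated integrals. *)
Definition leb3_preserving (T : T3 -> T3) : Prop :=
  measurable_fun setT T /\
  forall f : T3 -> \bar R, measurable_fun setT f -> (forall p, 0 <= f p)%E ->
    (\int[@leb3 R]_p f (T p) = \int[@leb3 R]_p f p)%E.

Lemma leb3_preserving_comp (S T : T3 -> T3) :
  leb3_preserving S -> leb3_preserving T -> leb3_preserving (S \o T).
Proof.
move=> [mS iS] [mT iT]; split; first exact: measurableT_comp.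
move=> f mf f0; rewrite -(iS f mf f0).
by apply: (iT (f \o S)) => [|p]; [exact: measurableT_comp|exact: f0].
Qed.

Lemma leb3_preserving_id : leb3_preserving idfun.
Proof. by split => //; exact: measurable_id. Qed.

Lemma leb3_preserving_ext (S T : T3 -> T3) :
  S =1 T -> leb3_preserving S -> leb3_preserving T.
Proof. by move/funext => ->. Qed.

Lemma ge0_integral_leb3 (f : T3 -> \bar R) :
  measurable_fun setT f -> (forall p, 0 <= f p)%E ->
  (\int[@leb3 R]_p f p =
   \int[mu]_x \int[mu]_y \int[mu]_z f ((x, y), z))%E.
Proof.
move=> mf f0; rewrite /leb3.
exact: ge0_integral_prod3.
Qed.

(** Tonelli reduces invariance in space to one-variable facts and exchanges of two integrals. *)
Lemma leb3_preserving_iterated (S : T3 -> T3) : measurable_fun setT S ->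
  (forall f : T3 -> \bar R, measurable_fun setT f -> (forall p, 0 <= f p)%E ->
    (\int[mu]_x \int[mu]_y \int[mu]_z f (S ((x, y), z)) =
     \int[mu]_x \int[mu]_y \int[mu]_z f ((x, y), z))%E) ->
  leb3_preserving S.
Proof.
move=> mS iS; split => // f mf f0.
rewrite (ge0_integral_leb3 mf f0) -(iS f mf f0).
apply: (@ge0_integral_leb3 (f \o S)) => [|p]; last exact: f0.
exact: measurableT_comp.
Qed.

Lemma leb3_preserving_swap_xy : leb3_preserving (fun p => ((p.1.2, p.1.1), p.2)).
Proof.
have mS : measurable_fun setT (fun p : T3 => ((p.1.2, p.1.1), p.2) : T3).
  apply: measurable_fun_pair; last exact: measurable_snd.
  apply: measurable_fun_pair.
  - exact: (measurableT_comp measurable_snd measurable_fst).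
  - exact: (measurableT_comp measurable_fst measurable_fst).
apply: (leb3_preserving_iterated mS) => f mf f0.
apply: (@fubini_tonelli _ _ _ _ _ mu mu
  (fun q => (\int[mu]_z f ((q.2, q.1), z))%E)); last first.
  by move=> q; apply: integral_ge0.
apply: (@measurable_fun_fubini_tonelli_F _ _ _ _ _ mu
  (fun p : T3 => f ((p.1.2, p.1.1), p.2))); last by move=> p; exact: f0.
exact: (measurableT_comp mf mS).
Qed.

Lemma leb3_preserving_swap_yz : leb3_preserving (fun p => ((p.1.1, p.2), p.1.2)).
Proof.
have mS : measurable_fun setT (fun p : T3 => ((p.1.1, p.2), p.1.2) : T3).
  apply: measurable_fun_pair; last exact: (measurableT_comp measurable_snd measurable_fst).
  apply: measurable_fun_pair; last exact: measurable_snd.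
  exact: (measurableT_comp measurable_fst measurable_fst).
apply: (leb3_preserving_iterated mS) => f mf f0.
apply: eq_integral => x _ /=.
apply: (@fubini_tonelli _ _ _ _ _ mu mu (fun q => f ((x, q.2), q.1))); last first.
  by move=> q; exact: f0.
apply: (measurableT_comp mf); apply: measurable_fun_pair; last exact: measurable_fst.
by apply: measurable_fun_pair => //; exact: measurable_snd.
Qed.

(** For fixed [x] and [y] the map translates [z] by a constant, so only the innermost integral is
    affected. *)
Lemma leb3_preserving_shear (h : TR * TR -> TR) : measurable_fun setT h ->
  leb3_preserving (fun p => (p.1, h p.1 + p.2)).
Proof.
move=> mh.
have mS : measurable_fun setT (fun p : T3 => (p.1, h p.1 + p.2) : T3).
  apply: measurable_fun_pair; first exact: measurable_fst.
  apply: (@measurable_funD _ _ R setT (fun p : T3 => h p.1) snd).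
  - exact: (measurableT_comp mh measurable_fst).
  - exact: measurable_snd.
apply: (leb3_preserving_iterated mS) => f mf f0.
apply: eq_integral => x _; apply: eq_integral => y _ /=.
apply: (@ge0_integral_shift R (fun z => f ((x, y), z))) => //.
exact: measurable_fun_pair2.
Qed.

Lemma leb3_preserving_oppz : leb3_preserving (fun p => (p.1, - p.2)).
Proof.
have mS : measurable_fun setT (fun p : T3 => (p.1, - p.2) : T3).
  apply: measurable_fun_pair; first exact: measurable_fst.
  exact: (measurableT_comp (@oppr_measurable R setT) measurable_snd).
apply: (leb3_preserving_iterated mS) => f mf f0.
apply: eq_integral => x _; apply: eq_integral => y _ /=.
apply: (@ge0_integralN R (fun z => f ((x, y), z))) => //.
exact: measurable_fun_pair2.
Qed.

End MeasurePreservingMaps.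

(** * Indices of 3 by 3 matrices *)

Notation i1 := (inord 1 : 'I_3).
Notation i2 := (inord 2 : 'I_3).

(** The indices are written as in [mat_apply], so that case analysis yields entries in the form
    occurring there. *)
Lemma ord3_ind (P : 'I_3 -> Prop) : P ord0 -> P i1 -> P i2 -> forall i, P i.
Proof.
move=> P0 P1 P2 [[|[|[|//]]] lti].
- by rewrite (_ : Ordinal lti = ord0)//; exact/val_inj.
- by rewrite (_ : Ordinal lti = i1)//; apply/val_inj; rewrite /= inordK.
- by rewrite (_ : Ordinal lti = i2)//; apply/val_inj; rewrite /= inordK.
Qed.

Lemma ord3_eqE : ((ord0 == i1) = false) * ((ord0 == i2) = false) *
  ((i1 == ord0) = false) * ((i1 == i2) = false) *
  ((i2 == ord0) = false) * ((i2 == i1) = false).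
Proof. by rewrite -!val_eqE /= !inordK. Qed.

Lemma sum_ord3 (V : nmodType) (F : 'I_3 -> V) :
  \sum_i F i = F ord0 + F i1 + F i2.
Proof.
rewrite !big_ord_recl big_ord0 addr0 addrA.
by congr (_ + F _ + F _); apply/val_inj; rewrite /= inordK.
Qed.

(** * Generation of the special linear group by transvections *)

Section SpecialLinear3.
Variable F : fieldType.
Implicit Type M : 'M[F]_3.

Lemma det_mx22 (N : 'M[F]_2) : \det N = N 0 0 * N 1 1 - N 0 1 * N 1 0.
Proof.
rewrite (expand_det_row _ 0) !big_ord_recl big_ord0 /cofactor !det_mx11 !mxE.
have -> : lift 0 0 = 1 :> 'I_2 by exact/val_inj.
have -> : lift 1 0 = 0 :> 'I_2 by exact/val_inj.
by rewrite /= !expr0 expr1; ring.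
Qed.

Lemma det_mx33 M : \det M =
  M ord0 ord0 * (M i1 i1 * M i2 i2 - M i1 i2 * M i2 i1)
  - M ord0 i1 * (M i1 ord0 * M i2 i2 - M i1 i2 * M i2 ord0)
  + M ord0 i2 * (M i1 ord0 * M i2 i1 - M i1 i1 * M i2 ord0).
Proof.
rewrite (expand_det_row _ ord0) sum_ord3 /cofactor !det_mx22 !mxE.
have l0 i : lift (ord0 : 'I_3) (i : 'I_2) = (inord i.+1 : 'I_3).
  by apply/val_inj; rewrite /= inordK // ltnS ltn_ord.
have l10 : lift i1 (0 : 'I_2) = ord0 by apply/val_inj; rewrite /= /bump inordK.
have l11 : lift i1 (1 : 'I_2) = i2 by apply/val_inj; rewrite /= /bump !inordK.
have l20 : lift i2 (0 : 'I_2) = ord0 by apply/val_inj; rewrite /= /bump inordK.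
have l21 : lift i2 (1 : 'I_2) = i1 by apply/val_inj; rewrite /= /bump !inordK.
rewrite !l0 l10 l11 l20 l21 /= !inordK //= !exprS expr0; ring.
Qed.

(** Left multiplication by this matrix adds [t] times row [j] to row [i]. *)
Definition transvection (i j : 'I_3) (t : F) : 'M[F]_3 :=
  1%:M + t *: delta_mx i j.

Lemma transvection_mulE i j t M k l :
  (transvection i j t *m M) k l = M k l + (k == i)%:R * (t * M j l).
Proof.
rewrite mulmxDl mul1mx -scalemxAl !mxE; congr (_ + _).
rewrite (bigD1 j)//= big1 => [|m mj]; last by rewrite !mxE (negbTE mj) andbF mul0r.
by rewrite !mxE eqxx andbT addr0 mulrCA.
Qed.

Lemma transvectionNK i j t M : i != j ->
  transvection i j (- t) *m (transvection i j t *m M) = M.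
Proof.
move=> ij; apply/matrixP => k l; rewrite !transvection_mulE.
by rewrite [j == i]eq_sym (negbTE ij) /=; ring.
Qed.

Lemma det_transvection_mul i j t M : i != j ->
  \det (transvection i j t *m M) = \det M.
Proof.
rewrite !det_mx33 !transvection_mulE.
elim/ord3_ind: i; elim/ord3_ind: j; rewrite ?eqxx// => _;
  by rewrite ?ord3_eqE ?eqxx /=; ring.
Qed.

(* Gaussian elimination: a determinant of 1 means that row additions alone reach
   the identity, each pivot being first created in the last row. *)
Lemma SL3_ind (P : 'M[F]_3 -> Prop) : P 1%:M ->
  (forall i j t M, i != j -> P (transvection i j t *m M) -> P M) ->
  forall M, \det M = 1 -> P M.
Proof.
move=> P1 Pop.
have n01 : ord0 != i1 by rewrite ord3_eqE.
have n02 : ord0 != i2 by rewrite ord3_eqE.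
have n10 : i1 != ord0 by rewrite ord3_eqE.
have n12 : i1 != i2 by rewrite ord3_eqE.
have n20 : i2 != ord0 by rewrite ord3_eqE.
have n21 : i2 != i1 by rewrite ord3_eqE.
pose E := (transvection_mulE, ord3_eqE, eqxx).
have utri M : M ord0 ord0 = 1 -> M i1 i1 = 1 -> M i2 i2 = 1 ->
    M i1 ord0 = 0 -> M i2 ord0 = 0 -> M i2 i1 = 0 -> P M.
  move=> a00 a11 a22 a10 a20 a21.
  apply: (Pop ord0 i1 (- M ord0 i1)) => //.
  (* The previous row operation has turned the last entry of row 0 into
     [M ord0 i2 - M ord0 i1 * M i1 i2]; the coefficient is its opposite. *)
  apply: (Pop ord0 i2 (M ord0 i1 * M i1 i2 - M ord0 i2)) => //.
  apply: (Pop i1 i2 (- M i1 i2)) => //.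
  rewrite [X in P X](_ : _ = 1%:M)//; apply/matrixP => k l.
  elim/ord3_ind: k; elim/ord3_ind: l;
    by rewrite !E !mxE ?ord3_eqE ?eqxx ?(a00, a11, a22, a10, a20, a21) /=; ring.
have piv2 M : \det M = 1 -> M ord0 ord0 = 1 -> M i1 ord0 = 0 -> M i2 ord0 = 0 ->
    M i1 i1 = 1 -> P M.
  move=> dM a00 a10 a20 a11; apply: (Pop i2 i1 (- M i2 i1)) => //.
  (* The determinant forces the last pivot: once the entry [(2, 1)] is cleared, the entry [(2, 2)]
     is 1. *)
  have a22 : M i2 i2 = 1 + M i1 i2 * M i2 i1.
    by rewrite -dM det_mx33 a00 a10 a20 a11; ring.
  by apply: utri; rewrite !E ?(a00, a11, a10, a20, a22) /=; ring.
have col2 M : \det M = 1 -> M ord0 ord0 = 1 -> M i1 ord0 = 0 -> M i2 ord0 = 0 ->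
    M i2 i1 != 0 -> P M.
  (* A nonzero entry below the pivot lets one row addition set the pivot to 1, without any row
     scaling. *)
  move=> dM a00 a10 a20 a21; apply: (Pop i1 i2 ((1 - M i1 i1) / M i2 i1)) => //.
  by apply: piv2; rewrite ?det_transvection_mul// !E ?(a00, a10, a20) /=; field.
have col1 M : \det M = 1 -> M ord0 ord0 = 1 -> M i1 ord0 = 0 -> M i2 ord0 = 0 -> P M.
  move=> dM a00 a10 a20; have [a21|] := eqVneq (M i2 i1) 0; last exact: col2.
  have a11 : M i1 i1 != 0.
    apply/eqP => a11; move: dM; rewrite det_mx33 a00 a10 a20 a21 a11.
    by rewrite !(mul0r, mulr0, subr0, addr0) => /eqP; rewrite eq_sym oner_eq0.
  (* The entry [(1, 1)] is nonzero, since otherwise the determinant vanishes; adding row 1 to row 2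
     copies it below. *)
  apply: (Pop i2 i1 1) => //; apply: col2; rewrite ?det_transvection_mul// !E;
    by rewrite ?(a00, a10, a20, a21) /= ?(mul0r, mulr0, addr0, add0r, mul1r).
have piv1 M : \det M = 1 -> M ord0 ord0 = 1 -> P M.
  move=> dM a00; apply: (Pop i1 ord0 (- M i1 ord0)) => //.
  apply: (Pop i2 ord0 (- M i2 ord0)) => //.
  by apply: col1; rewrite ?det_transvection_mul// !E ?a00 /=; ring.
have corner M : \det M = 1 -> M i2 ord0 != 0 -> P M.
  move=> dM a20; apply: (Pop ord0 i2 ((1 - M ord0 ord0) / M i2 ord0)) => //.
  by apply: piv1; rewrite ?det_transvection_mul// !E /=; field.
(* Some entry of the first column is nonzero; if it is not the last one, its row is added to the
   last row. *)
move=> M dM; have [a20|] := eqVneq (M i2 ord0) 0; last exact: corner.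
have [a10|a10] := eqVneq (M i1 ord0) 0; last first.
  apply: (Pop i2 i1 1) => //; apply: corner; rewrite ?det_transvection_mul// !E.
  by rewrite a20 add0r !mul1r.
apply: (Pop i2 ord0 1) => //; apply: corner; rewrite ?det_transvection_mul// !E.
rewrite a20 add0r !mul1r; apply/eqP => a00; move: dM.
rewrite det_mx33 a00 a10 a20 !(mul0r, mulr0, subr0, addr0) => /eqP.
by rewrite eq_sym oner_eq0.
Qed.

End SpecialLinear3.

(** * Change of variables under a rotation *)

Section RotatedCube.
Context {R : realType}.
Local Notation TR := (measurableTypeR R).
Local Notation T3 := (TR * TR * TR)%type.
Implicit Types (M : 'M[R]_3) (p : T3).

Lemma mat_applyE M p : mat_apply M p =
  pt3 (M ord0 ord0 * px p + M ord0 i1 * py p + M ord0 i2 * pz p)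
      (M i1 ord0 * px p + M i1 i1 * py p + M i1 i2 * pz p)
      (M i2 ord0 * px p + M i2 i1 * py p + M i2 i2 * pz p).
Proof. by rewrite /mat_apply !mxE !sum_ord3 !mxE /= !inordK. Qed.

Lemma mat_apply_mul M N p :
  mat_apply (M *m N) p = mat_apply M (mat_apply N p).
Proof.
rewrite !mat_applyE /pt3 /px /py /pz /= !mxE !sum_ord3.
by congr (_, _, _); ring.
Qed.

Lemma mat_apply1 p : mat_apply 1%:M p = p.
Proof.
rewrite mat_applyE !mxE !ord3_eqE !eqxx /= /pt3 /px /py /pz.
by case: p => [[x y] z] /=; congr (_, _, _); ring.
Qed.

Lemma leb3_preserving_transvection i j (t : R) : i != j ->
  leb3_preserving (mat_apply (transvection i j t)).
Proof.
have zx : leb3_preserving (fun p : T3 => (p.1, t * p.1.1 + p.2)).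
  apply: (leb3_preserving_shear (h := fun q => t * q.1)).
  by apply: (@measurable_funM _ _ R setT (cst t) fst) => //; exact: measurable_fst.
have zy : leb3_preserving (fun p : T3 => (p.1, t * p.1.2 + p.2)).
  apply: (leb3_preserving_shear (h := fun q => t * q.2)).
  by apply: (@measurable_funM _ _ R setT (cst t) snd) => //; exact: measurable_snd.
(* Only the shears that move [z] are available directly; the other four are their conjugates by
   coordinate swaps. *)
have conj (S T : T3 -> T3) : leb3_preserving S -> leb3_preserving T ->
    leb3_preserving (S \o (T \o S)).
  by move=> pS pT; do 2 apply: leb3_preserving_comp => //.
have yx := conj _ _ leb3_preserving_swap_yz zx.
have yz := conj _ _ leb3_preserving_swap_yz zy.
have xy := conj _ _ leb3_preserving_swap_xy yx.
have xz := conj _ _ leb3_preserving_swap_xy yz.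
elim/ord3_ind: i; elim/ord3_ind: j; rewrite ?eqxx// => _.
all: [> apply: leb3_preserving_ext xy | apply: leb3_preserving_ext xz
  | apply: leb3_preserving_ext yx | apply: leb3_preserving_ext yz
  | apply: leb3_preserving_ext zx | apply: leb3_preserving_ext zy ].
all: move=> [[x y] z]; rewrite mat_applyE !mxE !(ord3_eqE, eqxx).
all: by rewrite /pt3 /px /py /pz /=; congr (_, _, _); ring.
Qed.

Lemma leb3_preserving_mat_apply M : \det M = 1 -> leb3_preserving (mat_apply M).
Proof.
elim/SL3_ind => [|i j t {}M ij pM].
  by apply: leb3_preserving_ext leb3_preserving_id => p; rewrite mat_apply1.
apply: leb3_preserving_ext (leb3_preserving_comp
  (leb3_preserving_transvection (- t) ij) pM) => p /=.
by rewrite -mat_apply_mul transvectionNK.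
Qed.

Lemma measurable_unit_cube : measurable (@unit_cube R : set T3).
Proof.
rewrite [X in measurable X](_ : _ =
  (`[0, 1]%classic `*` `[0, 1]%classic) `*` `[0, 1]%classic); last first.
  apply/seteqP; split=> p /=; rewrite !in_itv /unit_cube /px /py /pz /=; tauto.
by do 2 apply: measurableX => //.
Qed.

(** Extending [f] by zero outside [D] reduces this to invariance over the whole space. *)
Lemma ge0_integral_preimage (S : T3 -> T3) (D : set T3) (f : T3 -> \bar R) :
  leb3_preserving S -> measurable D -> measurable_fun setT f ->
  (forall p, 0 <= f p)%E ->
  (\int[@leb3 R]_(p in S @^-1` D) f (S p) = \int[@leb3 R]_(p in D) f p)%E.
Proof.
move=> [mS iS] mD mf f0; rewrite integral_mkcond [RHS]integral_mkcond.
rewrite -(iS (f \_ D)).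
- by apply: eq_integral => p _; rewrite /patch.
- by apply/(measurable_restrictT _ mD); exact: measurable_funS mf.
- by move=> p; rewrite /patch; case: ifP.
Qed.

Lemma measurable_affine (a b c d : R) :
  measurable_fun setT (fun p : T3 => a * px p + b * py p + c * pz p + d).
Proof.
have mx : measurable_fun setT (@px R : T3 -> TR).
  exact: (measurableT_comp measurable_fst measurable_fst).
have my : measurable_fun setT (@py R : T3 -> TR).
  exact: (measurableT_comp measurable_snd measurable_fst).
have mz : measurable_fun setT (@pz R : T3 -> TR) by exact: measurable_snd.
apply: measurable_funD; last exact: measurable_cst.
apply: measurable_funD; last exact: measurable_funM.
by apply: measurable_funD; exact: measurable_funM.
Qed.

Definition height M p : R := M i2 ord0 * px p + M i2 i1 * py p + M i2 i2 * pz p.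

Lemma integral_S_R M (f : R -> R) : is_rotation M -> measurable_fun setT f ->
  (forall x, 0 <= f x) ->
  (\int[@leb3 R]_(p in S_R M) (f (pz p))%:E =
   \int[@leb3 R]_(p in @unit_cube R) (f (height M p - low M))%:E)%E.
Proof.
move=> [Mo Md] mf f0.
have Mo' : M *m M^T = 1%:M by apply: mulmx1C.
(* [S] undoes the rigid motion: it lifts by [low M], then applies the inverse rotation, so [S_R M]
   is the preimage of the cube. *)
pose S p : T3 := mat_apply M^T (p.1, low M + p.2).
have pS : leb3_preserving S.
  apply: (@leb3_preserving_comp _ (mat_apply M^T) (fun p : T3 => (p.1, low M + p.2))).
    by apply: leb3_preserving_mat_apply; rewrite det_tr.
  by apply: (leb3_preserving_shear (h := cst (low M))).
rewrite -(ge0_integral_preimage pS measurable_unit_cube); last 2 first.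
- by apply/measurable_EFinP/(measurableT_comp mf); exact: measurable_affine.
- by move=> p; rewrite lee_fin.
have -> : S @^-1` @unit_cube R = S_R M.
  apply/seteqP; split => [p Sp|_ [q cq <-]].
    exists (S p) => //; rewrite /S -mat_apply_mul Mo' mat_apply1.
    by rewrite /pt3 /px /py /pz /= addrC addKr; case: p {Sp} => [[]].
  rewrite /preimage /= /S /pt3 /= addrC subrK.
  have -> : (px (mat_apply M q), py (mat_apply M q), pz (mat_apply M q)) =
      mat_apply M q by case: (mat_apply M q) => [[]].
  by rewrite -mat_apply_mul Mo mat_apply1.
apply: eq_integral => p _; congr ((f _)%:E).
have : mat_apply M (S p) = (p.1, low M + p.2).
  by rewrite /S -mat_apply_mul Mo' mat_apply1.
by rewrite mat_applyE /pt3 /height => -[_ ->]; rewrite /pz; ring.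
Qed.


End RotatedCube.

(** * Lowest point and symmetries of the unit cube *)

Section UnitCube.
Context {R : realType}.
Local Notation TR := (measurableTypeR R).
Local Notation T3 := (TR * TR * TR)%type.
Implicit Types (M : 'M[R]_3) (p : T3) (a b c : R).

(** A linear form is minimised over the cube one coordinate at a time, at the vertex with coordinate
    1 exactly where the coefficient is negative. *)
Lemma lowE M :
  low M = Num.min (M i2 ord0) 0 + Num.min (M i2 i1) 0 + Num.min (M i2 i2) 0.
Proof.
set m := RHS; rewrite /low; set A := [set _ | _ in _].
have min_le (a x : R) : 0 <= x <= 1 -> Num.min a 0 <= a * x.
  by move=> x01; rewrite /Num.min; case: ltP => a0; nra.
have lbA : lbound A m.
  move=> _ [p [xp [yp zp]] <-]; rewrite mat_applyE /=.
  by rewrite !lerD// min_le.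
have Am : A m.
  pose v (a : R) : R := if a < 0 then 1 else 0.
  have minE (a : R) : a * v a = Num.min a 0.
    by rewrite /v /Num.min; case: ifP => _; rewrite ?mulr1 ?mulr0.
  have v01 (a : R) : 0 <= v a <= 1 by rewrite /v; case: ifP; lra.
  exists (pt3 (v (M i2 ord0)) (v (M i2 i1)) (v (M i2 i2))).
    by split; [|split]; exact: v01.
  by rewrite mat_applyE /= /px /py /pz /= !minE.
apply/eqP; rewrite eq_le; apply/andP; split.
  by apply: ge_inf => //; exists m.
by apply: lb_le_inf => //; exists m.
Qed.

Definition reflect01 (e : bool) (x : R) : R := if e then 1 - x else x.

Lemma leb3_preserving_reflect (e1 e2 e3 : bool) : leb3_preserving
  (fun p => pt3 (reflect01 e1 (px p)) (reflect01 e2 (py p)) (reflect01 e3 (pz p))).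
Proof.
have rz (e : bool) : leb3_preserving (fun p : T3 => (p.1, reflect01 e p.2)).
  case: e; last by apply: leb3_preserving_ext leb3_preserving_id => -[[]].
  exact: (leb3_preserving_comp (leb3_preserving_shear (h := cst 1)
    (measurable_cst _)) leb3_preserving_oppz).
have ry e := leb3_preserving_comp leb3_preserving_swap_yz
  (leb3_preserving_comp (rz e) leb3_preserving_swap_yz).
have rx e := leb3_preserving_comp leb3_preserving_swap_xy
  (leb3_preserving_comp (ry e) leb3_preserving_swap_xy).
by apply: leb3_preserving_ext (leb3_preserving_comp (rx e1)
  (leb3_preserving_comp (ry e2) (rz e3))).
Qed.

(** For [a < 0], replacing [x] by [1 - x] turns [a * x] into [|a| * x + a], and the constant cancels
    against the minimum. The final [+ 0] keeps the form of [measurable_affine]. *)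
Lemma integral_cube_norm (f : R -> R) a b c : measurable_fun setT f ->
  (forall x, 0 <= f x) ->
  (\int[@leb3 R]_(p in @unit_cube R)
     (f (a * px p + b * py p + c * pz p
         - (Num.min a 0 + Num.min b 0 + Num.min c 0)))%:E =
   \int[@leb3 R]_(p in @unit_cube R)
     (f (`|a| * px p + `|b| * py p + `|c| * pz p + 0))%:E)%E.
Proof.
move=> mf f0.
rewrite -(ge0_integral_preimage
  (leb3_preserving_reflect (a < 0) (b < 0) (c < 0)) measurable_unit_cube); last 2 first.
- by apply/measurable_EFinP/(measurableT_comp mf); exact: measurable_affine.
- by move=> p; rewrite lee_fin.
have r01 e x : (0 <= reflect01 e x <= 1) = (0 <= x <= 1).
  by case: e => //=; apply/idP/idP; lra.
rewrite (_ : _ @^-1` _ = @unit_cube R); last first.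
  by apply/seteqP; split => p; rewrite /unit_cube /preimage /pt3 /px /py /pz /= !r01.
have rE d x : d * reflect01 (d < 0) x = `|d| * x + Num.min d 0.
  by rewrite /reflect01 /Num.min; case: ltrP => d0; [rewrite ltr0_norm|rewrite ger0_norm]; lra.
apply: eq_integral => p _; congr ((f _)%:E).
by rewrite /pt3 /px /py /pz /= !rE; ring.
Qed.

Lemma integral_cube_cycle (f : T3 -> \bar R) : measurable_fun setT f ->
  (forall p, 0 <= f p)%E ->
  (\int[@leb3 R]_(p in @unit_cube R) f (pt3 (py p) (pz p) (px p)) =
   \int[@leb3 R]_(p in @unit_cube R) f p)%E.
Proof.
move=> mf f0.
have pC : leb3_preserving (fun p => pt3 (py p) (pz p) (px p)).
  exact: (leb3_preserving_comp leb3_preserving_swap_yz leb3_preserving_swap_xy).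
rewrite -(ge0_integral_preimage pC measurable_unit_cube mf f0).
congr (integral _ _ _); apply/seteqP; split => p;
  rewrite /unit_cube /preimage /pt3 /px /py /pz /=; tauto.
Qed.

(* The junk value [0 `^ (- 2^-1) = 0] makes pointwise bounds on the integrand
   fail on the faces through the origin, hence their removal. *)
Definition cube_pos : set T3 :=
  @unit_cube R `\` [set p | px p = 0] `\` [set p | py p = 0] `\` [set p | pz p = 0].

Lemma cube_posP p : cube_pos p <->
  [/\ 0 < px p <= 1, 0 < py p <= 1 & 0 < pz p <= 1].
Proof.
split.
  move=> [[[[/andP[x0 x1] [/andP[y0 y1] /andP[z0 z1]]] /eqP xn] /eqP yn] /eqP zn].
  by rewrite x1 y1 z1 !lt_def xn yn zn x0 y0 z0.
move=> [/andP[x0 x1] /andP[y0 y1] /andP[z0 z1]].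
do 3![split; last by apply/eqP; rewrite gt_eqF].
by rewrite /unit_cube /= x1 y1 z1 !ltW.
Qed.

Lemma measurable_coordinate_planes :
  [/\ measurable ([set p | px p = 0] : set T3),
      measurable ([set p | py p = 0] : set T3) &
      measurable ([set p | pz p = 0] : set T3)].
Proof.
have m0 : measurable ([set 0] : set TR) by exact: measurable_set1.
have -> : [set p | px p = 0] = ([set 0] `*` setT) `*` setT :> set T3.
  by apply/seteqP; split => p /=; tauto.
have -> : [set p | py p = 0] = (setT `*` [set 0]) `*` setT :> set T3.
  by apply/seteqP; split => p /=; tauto.
have -> : [set p | pz p = 0] = (setT `*` setT) `*` [set 0] :> set T3.
  by apply/seteqP; split => p /=; tauto.
by split; do 2 apply: measurableX => //.
Qed.

Lemma measurable_cube_pos : measurable cube_pos.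
Proof.
have [mx my mz] := measurable_coordinate_planes.
by do 3 apply: measurableD => //; exact: measurable_unit_cube.
Qed.

End UnitCube.

(** * Null faces and the convexity inequality *)

Section Jensen.
Context {R : realType}.
Local Notation mu := (@lebesgue_measure R).
Local Notation TR := (measurableTypeR R).
Local Notation T3 := (TR * TR * TR)%type.
Local Notation "t `^-1/2" := (powR t (- 2^-1)) (at level 2).

Lemma leb3_box (A B C : set TR) : measurable A -> measurable B -> measurable C ->
  (leb3 ((A `*` B) `*` C) = mu A * mu B * mu C)%E.
Proof.
move=> mA mB mC; transitivity ((mu \x mu)%E (A `*` B) * mu C)%E.
  by apply: product_measure1E => //; exact: measurableX.
by congr (_ * _)%E; exact: product_measure1E.
Qed.

Lemma leb3_coordinate_planes :
  [/\ leb3 ([set p | px p = 0] : set T3) = 0%E,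
      leb3 ([set p | py p = 0] : set T3) = 0%E &
      leb3 ([set p | pz p = 0] : set T3) = 0%E].
Proof.
have m0 : measurable ([set 0] : set TR) by exact: measurable_set1.
have mu0 : mu [set 0] = 0%E by exact: lebesgue_measure_set1.
split.
- rewrite (_ : [set p | px p = 0] = ([set 0] `*` setT) `*` setT); last first.
    by apply/seteqP; split => p /=; tauto.
  by rewrite leb3_box// mu0 !mul0e.
- rewrite (_ : [set p | py p = 0] = (setT `*` [set 0]) `*` setT); last first.
    by apply/seteqP; split => p /=; tauto.
  by rewrite leb3_box// mu0 mule0 mul0e.
- rewrite (_ : [set p | pz p = 0] = (setT `*` setT) `*` [set 0]); last first.
    by apply/seteqP; split => p /=; tauto.
  by rewrite leb3_box// mu0 mule0.
Qed.

Lemma integral_cube_pos (f : T3 -> \bar R) : measurable_fun setT f ->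
  (forall p, 0 <= f p)%E ->
  (\int[@leb3 R]_(p in @unit_cube R) f p = \int[@leb3 R]_(p in @cube_pos R) f p)%E.
Proof.
move=> mf f0; have [mx my mz] := @measurable_coordinate_planes R.
have [nx ny nz] := leb3_coordinate_planes.
have mD := @measurable_unit_cube R.
have mDx := measurableD mD mx; have mDy := measurableD mDx my.
have mfS D : measurable_fun (D : set T3) f by exact: measurable_funS mf.
rewrite (ge0_negligible_integral mx mD (mfS _) (fun p _ => f0 p) nx).
rewrite (ge0_negligible_integral my mDx (mfS _) (fun p _ => f0 p) ny).
by rewrite (ge0_negligible_integral mz mDy (mfS _) (fun p _ => f0 p) nz).
Qed.

Lemma powR_inv_sqrt (t : R) : 0 <= t -> t `^-1/2 = (Num.sqrt t)^-1.
Proof. by move=> t0; rewrite powRN powR12_sqrt. Qed.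

(* The graph of [t `^-1/2] lies above its tangent at [m]; in terms of square roots
   the gap is a multiple of [(r - q)^2 (r + 2 q)]. *)
Lemma powR_inv_sqrt_tangent (m t : R) : 0 < m -> 0 < t ->
  m `^-1/2 - (t - m) / (2 * m * Num.sqrt m) <= t `^-1/2.
Proof.
move=> m0 t0; rewrite (powR_inv_sqrt (ltW m0)) (powR_inv_sqrt (ltW t0)).
have q0 : 0 < Num.sqrt m by rewrite sqrtr_gt0.
have r0 : 0 < Num.sqrt t by rewrite sqrtr_gt0.
have mE := sqr_sqrtr (ltW m0); have tE := sqr_sqrtr (ltW t0).
move: (Num.sqrt m) (Num.sqrt t) q0 r0 mE tE => q r q0 r0 <- <-.
rewrite -subr_ge0.
rewrite (_ : _ - _ = (r - q) ^+ 2 * (r + 2 * q) / (2 * q ^+ 3 * r)).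
  apply: divr_ge0; first by rewrite mulr_ge0 ?sqr_ge0//; lra.
  by rewrite ltW// !mulr_gt0// exprn_gt0.
by field; rewrite !gt_eqF.
Qed.

(** Sum of the three tangent inequalities at [m]. The tangent slope is negative, so an upper bound
    on [u + v + w] is enough. *)
Lemma powR_inv_sqrt_jensen (u v w m : R) : 0 < u -> 0 < v -> 0 < w -> 0 < m ->
  u + v + w <= 3 * m ->
  m `^-1/2 + m `^-1/2 + m `^-1/2 <= u `^-1/2 + v `^-1/2 + w `^-1/2.
Proof.
move=> u0 v0 w0 m0 uvw.
have := powR_inv_sqrt_tangent m0 u0; have := powR_inv_sqrt_tangent m0 v0.
have := powR_inv_sqrt_tangent m0 w0.
set k := (2 * m * Num.sqrt m)^-1.
have k0 : 0 <= k by rewrite invr_ge0 !mulr_ge0 ?sqrtr_ge0 ?ltW.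
by nra.
Qed.

End Jensen.

(** * Evaluation of the integral for equal coefficients *)

Section IteratedIntegral.
Context {R : realType}.
Local Notation mu := (@lebesgue_measure R).
Local Notation TR := (measurableTypeR R).
Local Notation T3 := (TR * TR * TR)%type.
Implicit Types (c x : R).

Lemma is_derive_addl c x : is_derive x 1 (fun y : R => c + y) (1 : R).
Proof.
apply: (is_derive_eq (is_deriveD (is_derive_cst c x 1) (is_derive_id x 1))).
by rewrite add0r.
Qed.

Lemma is_derive_sqrt_shift c x : 0 < c + x ->
  is_derive x 1 (fun y => Num.sqrt (c + y)) (2 * Num.sqrt (c + x))^-1.
Proof.
move=> cx0.
have d1 := is_derive_addl c x.
have d2 : is_derive (c + x) 1 (@Num.sqrt R) (2 * Num.sqrt (c + x))^-1.
  exact: is_derive1_sqrt.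
by apply: is_derive_eq (is_derive1_comp d2 d1) _; rewrite mulr1.
Qed.

(** This is the power rule for the exponent [n + 3/2], with half-integer powers written as an
    integer power times a square root. *)
Lemma is_derive_expr_sqrt_shift n c x : 0 < c + x ->
  is_derive x 1 (fun y => (c + y) ^+ n.+1 * Num.sqrt (c + y))
    ((n.+1%:R + 2^-1) * (c + x) ^+ n * Num.sqrt (c + x)).
Proof.
move=> cx0; have ds := is_derive_sqrt_shift cx0.
have d1 := is_derive_addl c x.
have dX : is_derive x 1 (fun y : R => (c + y) ^+ n.+1) (n.+1%:R * (c + x) ^+ n).
  have := is_deriveX n.+1 d1; rewrite exprfctE => dX.
  by apply: is_derive_eq dX _; rewrite -[LHS]/(_ * 1) mulr1.
apply: is_derive_eq (is_deriveM dX ds) _.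
set q := Num.sqrt (c + x).
have q0 : q != 0 by rewrite gt_eqF // sqrtr_gt0.
rewrite -[LHS]/((c + x) ^+ n.+1 * (2 * q)^-1 + q * (n.+1%:R * (c + x) ^+ n)).
by rewrite exprS -{1}(sqr_sqrtr (ltW cx0)) -/q; field.
Qed.

(** The interval is open at 0 to match the slices of [cube_pos]; adding the endpoint does not change
    the integral. *)
Lemma integral_FTC01 (f F : R -> R) : {in `[0, 1], continuous f} ->
  continuous F -> (forall x, 0 < x < 1 -> is_derive x 1 F (f x)) ->
  (\int[mu]_(x in `]0%R, 1%R]) (f x)%:E = (F 1 - F 0)%:E)%E.
Proof.
move=> cf cF dF.
have cfW : {within `[0, 1], continuous f}.
  by apply: continuous_in_subspaceT => x; rewrite inE => x01; exact: cf.
have mf : measurable_fun (`]0, 1]%classic : set TR) (EFin \o f).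
  apply/measurable_EFinP.
  apply: (@measurable_funS _ _ TR TR `[0, 1]%classic) => //.
    by apply: subset_itv; rewrite bnd_simp.
  exact: subspace_continuous_measurable_fun.
rewrite (integral_itv_obnd_cbnd mf) EFinB.
apply: continuous_FTC2 => //.
- split.
  + by move=> x; rewrite in_itv /= => /dF [].
  + exact: cvg_at_right_filter (cF 0).
  + exact: cvg_at_left_filter (cF 1).
- by move=> x; rewrite in_itv /= => /dF dFx; rewrite derive1E derive_val.
Qed.

Lemma continuous_expr_sqrt_shift n c :
  continuous (fun y : R => (c + y) ^+ n * Num.sqrt (c + y)).
Proof.
move=> x; have cx : {for x, continuous (fun y : R => c + y)}.
  by apply: continuousD; [exact: cst_continuous|exact: cvg_id].
apply: cvgM.
  exact: (continuous_comp cx (@exprn_continuous _ n _)).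
exact: (continuous_comp cx (@sqrt_continuous _ _)).
Qed.

Lemma ge0_integral_cube_pos (f : T3 -> \bar R) : measurable_fun setT f ->
  (forall p, 0 <= f p)%E ->
  (\int[@leb3 R]_(p in @cube_pos R) f p =
   \int[mu]_(x in `]0%R, 1%R]) \int[mu]_(y in `]0%R, 1%R])
     \int[mu]_(z in `]0%R, 1%R]) f ((x, y), z))%E.
Proof.
move=> mf f0; have mD := @measurable_cube_pos R.
rewrite integral_mkcond ge0_integral_leb3; last 2 first.
- by apply/(measurable_restrictT _ mD); exact: measurable_funS mf.
- by move=> p; rewrite /patch; case: ifP.
rewrite [RHS]integral_mkcond; apply: eq_integral => x _.
rewrite [RHS]/patch; case: ifPn => [|/negP] xI; last first.
  apply: integral0_eq => y _; apply: integral0_eq => z _.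
  rewrite /patch ifN//; apply/negP => /[1!inE] /cube_posP[? ? ?]; apply: xI.
  by rewrite inE /= in_itv.
rewrite [RHS]integral_mkcond; apply: eq_integral => y _.
rewrite [RHS]/patch; case: ifPn => [|/negP] yI; last first.
  apply: integral0_eq => z _.
  rewrite /patch ifN//; apply/negP => /[1!inE] /cube_posP[? ? ?]; apply: yI.
  by rewrite inE /= in_itv.
rewrite [RHS]integral_mkcond; apply: eq_integral => z _.
rewrite /patch (_ : ((x, y, z) \in cube_pos) = (z \in `]0, 1]%classic))//.
move: xI yI; rewrite !inE /= !in_itv /= => /andP[x0 x1] /andP[y0 y1].
apply/idP/idP; rewrite !inE /= in_itv /= => zI; first by case/cube_posP: zI.
by apply/cube_posP; split; rewrite //= ?x0 ?y0.
Qed.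

Lemma is_derive_scale (k x df : R) (f : R -> R) :
  is_derive x 1 f df -> is_derive x 1 (fun y => k * f y) (k * df).
Proof. exact: is_deriveZ. Qed.

Lemma continuous_scale (k : R) (f : R -> R) (x : R) :
  {for x, continuous f} -> {for x, continuous (fun y => k * f y)}.
Proof. by move=> cf; apply: cvgM => //; exact: cvg_cst. Qed.

(** The successive antiderivatives of [t^(-1/2)] are [2 t^(1/2)], [4/3 t^(3/2)] and [8/15 t^(5/2)];
    each integration over a unit interval takes one finite difference. *)
Lemma integral_inv_sqrt_cube (k : R) :
  (\int[mu]_(x in `]0%R, 1%R]) \int[mu]_(y in `]0%R, 1%R])
     \int[mu]_(z in `]0%R, 1%R]) (k * (Num.sqrt (x + y + z))^-1)%:E =
   (k * (8 / 5 * (1 + 3 * Num.sqrt 3 - 4 * Num.sqrt 2)))%:E)%E.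
Proof.
(* [h n c y] stands for [(c + y)^(n + 1/2)]. *)
pose h n c y : R := (c + y) ^+ n * Num.sqrt (c + y).
have ch n c : continuous (h n c) by exact: continuous_expr_sqrt_shift.
have dh n c x : 0 < c + x ->
    is_derive x 1 (h n.+1 c) ((n.+1%:R + 2^-1) * h n c x).
  by move=> cx0; rewrite mulrA; exact: is_derive_expr_sqrt_shift.
have int_z x y : 0 < x -> 0 < y ->
    (\int[mu]_(z in `]0%R, 1%R]) (k * (Num.sqrt (x + y + z))^-1)%:E =
     (2 * k * (h 0%N (x + 1) y - h 0%N x y))%:E)%E.
  move=> x0 y0.
  have csq z : {for z, continuous (fun u => Num.sqrt (x + y + u))}.
    have := ch 0%N (x + y) z; rewrite /h.
    by under eq_fun do rewrite expr0 mul1r.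
  have cf : {in `[0, 1], continuous (fun z => k * (Num.sqrt (x + y + z))^-1)}.
    move=> z; rewrite in_itv /= => /andP[z0 _].
    apply: (@continuous_scale k (fun u => (Num.sqrt (x + y + u))^-1)).
    apply: (@continuousV _ _ (fun u => Num.sqrt (x + y + u))) => //.
    (* Positivity of [x] and [y] keeps the integrand continuous up to [z = 0]. *)
    by rewrite gt_eqF // sqrtr_gt0; lra.
  have cF : continuous (fun z => 2 * k * Num.sqrt (x + y + z)).
    by move=> z; exact: (@continuous_scale (2 * k) (fun u => Num.sqrt (x + y + u))).
  have dF (z : R) : 0 < z < 1 -> is_derive z 1 (fun u => 2 * k * Num.sqrt (x + y + u))
      (k * (Num.sqrt (x + y + z))^-1).
    move=> /andP[z0 _]; have xyz : 0 < x + y + z by lra.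
    apply: is_derive_eq (is_derive_scale (2 * k) (is_derive_sqrt_shift xyz)) _.
    by field; rewrite gt_eqF // sqrtr_gt0.
  rewrite (integral_FTC01 cf cF dF).
  by rewrite /h addr0 [x + y + 1]addrAC !expr0 !mul1r mulrBr.
have int_y x : 0 < x ->
    (\int[mu]_(y in `]0%R, 1%R]) (2 * k * (h 0%N (x + 1) y - h 0%N x y))%:E =
     (4 / 3 * k * (h 1%N 2 x - 2 * h 1%N 1 x + h 1%N 0 x))%:E)%E.
  move=> x0.
  have cF (l : R) n : continuous (fun y => l * (h n (x + 1) y - h n x y)).
    move=> y; apply: (@continuous_scale l (h n (x + 1) \- h n x)).
    by apply: cvgB; exact: ch.
  have dF (y : R) : 0 < y < 1 ->
      is_derive y 1 (fun u => 4 / 3 * k * (h 1%N (x + 1) u - h 1%N x u))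
        (2 * k * (h 0%N (x + 1) y - h 0%N x y)).
    move=> /andP[y0 _].
    apply: is_derive_eq (is_derive_scale (4 / 3 * k)
      (is_deriveB (dh 0%N (x + 1) y _) (dh 0%N x y _))) _; [lra|lra|].
    by field.
  rewrite (integral_FTC01 (fun y _ => cF (2 * k) 0%N y) (cF (4 / 3 * k) 1%N) dF).
  have e2 : x + 1 + 1 = 2 + x by ring.
  by rewrite /h e2 !addr0 add0r [x + 1]addrC; congr (_%:E); ring.
under eq_integral => x /[!inE] /= /[!in_itv] /= /andP[x0 _].
  under eq_integral => y /[!inE] /= /[!in_itv] /= /andP[y0 _].
    by rewrite int_z//; over.
  by rewrite int_y//; over.
have cF (l : R) n : continuous (fun x => l * (h n 2 x - 2 * h n 1 x + h n 0 x)).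
  move=> x; apply: (@continuous_scale l (fun u => h n 2 u - 2 * h n 1 u + h n 0 u)).
  apply: cvgD; last exact: ch.
  by apply: cvgB; [exact: ch|exact: (@continuous_scale 2 (h n 1) x (ch _ _ _))].
have dF (x : R) : 0 < x < 1 ->
    is_derive x 1 (fun u => 8 / 15 * k * (h 2%N 2 u - 2 * h 2%N 1 u + h 2%N 0 u))
      (4 / 3 * k * (h 1%N 2 x - 2 * h 1%N 1 x + h 1%N 0 x)).
  move=> /andP[x0 _].
  apply: is_derive_eq (is_derive_scale (8 / 15 * k) (is_deriveD
    (is_deriveB (dh 1%N 2 x _) (is_derive_scale 2 (dh 1%N 1 x _)))
    (dh 1%N 0 x _))) _; [lra|lra|lra|].
  by field.
rewrite (integral_FTC01 (fun x _ => cF (4 / 3 * k) 1%N x) (cF (8 / 15 * k) 2%N) dF).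
have e3 : 2 + 1 = 3 :> R by ring.
have e2 : 1 + 1 = 2 :> R by ring.
(* The third difference of [t^(5/2)] at 0 is [9 sqrt 3 - 12 sqrt 2 + 3]. *)
by rewrite /h e3 e2 !addr0 add0r sqrtr0 sqrtr1; congr (_%:E); field.
Qed.

End IteratedIntegral.

(** Serves to integrate the convexity inequality, which holds pointwise only for the sum of three
    integrands. *)
Lemma ge0_le_integral_sum3 (d : measure_display) (T : measurableType d)
  (R : realType) (m : {measure set T -> \bar R}) (D : set T)
  (j f g h : T -> \bar R) : measurable D ->
  measurable_fun D j -> measurable_fun D f -> measurable_fun D g ->
  measurable_fun D h -> (forall x, 0 <= j x)%E -> (forall x, 0 <= f x)%E ->
  (forall x, 0 <= g x)%E -> (forall x, 0 <= h x)%E ->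
  (forall x, D x -> j x + j x + j x <= f x + g x + h x)%E ->
  (\int[m]_(x in D) j x + \int[m]_(x in D) j x + \int[m]_(x in D) j x <=
   \int[m]_(x in D) f x + \int[m]_(x in D) g x + \int[m]_(x in D) h x)%E.
Proof.
move=> mD mj mf mg mh j0 f0 g0 h0 jfgh.
have sum3 (u v w : T -> \bar R) : measurable_fun D u -> measurable_fun D v ->
    measurable_fun D w -> (forall x, 0 <= u x)%E -> (forall x, 0 <= v x)%E ->
    (forall x, 0 <= w x)%E ->
    (\int[m]_(x in D) u x + \int[m]_(x in D) v x + \int[m]_(x in D) w x =
     \int[m]_(x in D) (u x + v x + w x))%E.
  move=> mu mv mw u0 v0 w0.
  by rewrite -ge0_integralD// -ge0_integralD//;
    [move=> x _; rewrite adde_ge0|exact: emeasurable_funD].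
rewrite !sum3//; apply: ge0_le_integral => //.
- by move=> x _; rewrite !adde_ge0.
- by do 2 apply: emeasurable_funD => //.
- by do 2 apply: emeasurable_funD => //.
Qed.

(** * Drainage time as a function of the vertical direction *)

Section DrainageTime.
Context {R : realType}.
Local Notation mu := (@lebesgue_measure R).
Local Notation TR := (measurableTypeR R).
Local Notation T3 := (TR * TR * TR)%type.
Local Notation phi t := (powR t (- (2^-1))).
Implicit Types (a b c s : R) (M : 'M[R]_3).

(** For a nonnegative unit vector [(a, b, c)] this is [K] times the drainage time of the cube
    standing on the vertex at the origin, with [(a, b, c)] pointing up. *)
Definition cube_time a b c : \bar R :=
  (\int[@leb3 R]_(p in @unit_cube R)
     (phi (a * px p + b * py p + c * pz p + 0))%:E)%E.

Lemma measurable_phi_affine a b c : measurable_fun setT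
  (fun p : T3 => (phi (a * px p + b * py p + c * pz p + 0))%:E).
Proof.
apply/measurable_EFinP/(measurableT_comp (measurable_powR _)).
exact: measurable_affine.
Qed.

Lemma phi_affine_ge0 a b c (p : T3) :
  (0 <= (phi (a * px p + b * py p + c * pz p + 0))%:E)%E.
Proof. by rewrite lee_fin powR_ge0. Qed.

Lemma cube_time_cycle a b c : cube_time c a b = cube_time a b c.
Proof.
rewrite /cube_time -(integral_cube_cycle (measurable_phi_affine a b c)
  (@phi_affine_ge0 a b c)).
by apply: eq_integral => p _; congr (phi _)%:E; rewrite /pt3 /px /py /pz /=; ring.
Qed.

Lemma cube_time_pos a b c : cube_time a b c =
  (\int[@leb3 R]_(p in @cube_pos R)
     (phi (a * px p + b * py p + c * pz p + 0))%:E)%E.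
Proof.
exact: (integral_cube_pos (measurable_phi_affine a b c) (@phi_affine_ge0 a b c)).
Qed.

(** The factor [s] comes out of the integrand by homogeneity of degree [-1/2]. *)
Lemma cube_time_diag s : 0 < s -> cube_time s s s =
  ((Num.sqrt s)^-1 * (8 / 5 * (1 + 3 * Num.sqrt 3 - 4 * Num.sqrt 2)))%:E.
Proof.
move=> s0; rewrite cube_time_pos ge0_integral_cube_pos; last 2 first.
- exact: measurable_phi_affine.
- exact: phi_affine_ge0.
rewrite -integral_inv_sqrt_cube.
apply: eq_integral => x /[!inE] /= /[!in_itv] /= /andP[x0 _].
apply: eq_integral => y /[!inE] /= /[!in_itv] /= /andP[y0 _].
apply: eq_integral => z /[!inE] /= /[!in_itv] /= /andP[z0 _].
congr (_%:E); rewrite /px /py /pz /= addr0 -!mulrDr.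
rewrite powR_inv_sqrt; last by apply: mulr_ge0; lra.
by rewrite sqrtrM ?ltW// invfM.
Qed.

Lemma cube_time_min a b c : 0 <= a -> 0 <= b -> 0 <= c ->
  a ^+ 2 + b ^+ 2 + c ^+ 2 = 1 ->
  (cube_time (Num.sqrt 3)^-1 (Num.sqrt 3)^-1 (Num.sqrt 3)^-1 <= cube_time a b c)%E.
Proof.
move=> a0 b0 c0 abc1; set s := (Num.sqrt 3)^-1.
have s0 : 0 < s by rewrite invr_gt0 sqrtr_gt0.
have s2 : s ^+ 2 = 3^-1 by rewrite exprVn sqr_sqrtr.
(* Cauchy-Schwarz, through the sum of the squared differences. *)
have abc3 : a + b + c <= 3 * s.
  rewrite -(@ler_pXn2r _ 2) ?nnegrE//; [|lra|lra].
  have -> : (3 * s) ^+ 2 = 3 * (a ^+ 2 + b ^+ 2 + c ^+ 2).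
    by rewrite exprMn s2 abc1; field.
  rewrite -subr_ge0.
  rewrite (_ : _ - _ = (a - b) ^+ 2 + (b - c) ^+ 2 + (a - c) ^+ 2); last by ring.
  by rewrite !addr_ge0// sqr_ge0.
have abc0 : 0 < a + b + c by rewrite lt_def; apply/andP; split; [apply/eqP|]; nra.
suff : (cube_time s s s + cube_time s s s + cube_time s s s <=
        cube_time a b c + cube_time a b c + cube_time a b c)%E.
  (* Dividing by 3 in the extended reals: the left side is finite, so the value of [cube_time a b c]
     is real or infinite of either sign. *)
  rewrite cube_time_diag//; set J := (_ * _ : R).
  case: (cube_time a b c) => [r| |]; last by rewrite -!EFinD leeNy_eq.
    by rewrite -!EFinD !lee_fin; lra.
  by move=> _; exact: leey.
(* The three equal terms become the integrals for the three cyclic permutations of [(a, b, c)]. *)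
rewrite -{2}(cube_time_cycle a b c) {2}(cube_time_cycle b c a).
have mD := @measurable_cube_pos R.
have mphi a' b' c' := measurable_funS measurableT (@subsetT _ (@cube_pos R))
  (measurable_phi_affine a' b' c').
rewrite !cube_time_pos.
apply: (@ge0_le_integral_sum3 _ _ R ((mu \x mu) \x mu)%E (@cube_pos R)); first exact: mD.
1-4: exact: mphi.
1-4: exact: phi_affine_ge0.
move=> p /cube_posP[/andP[x0 _] /andP[y0 _] /andP[z0 _]].
rewrite -!EFinD lee_fin; move: (px p) (py p) (pz p) x0 y0 z0 => x y z x0 y0 z0.
(* Some coefficients may vanish; one positive coefficient suffices because all coordinates are
   positive. *)
have pos d e f : 0 <= d -> 0 <= e -> 0 <= f -> 0 < d + e + f ->
    0 < d * x + e * y + f * z + 0.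
  move=> d0 e0 f0 def0; have dx := mulr_ge0 d0 (ltW x0).
  have ey := mulr_ge0 e0 (ltW y0); have fz := mulr_ge0 f0 (ltW z0).
  have [dp|d_le] := ltP 0 d; first by have := mulr_gt0 dp x0; lra.
  have [ep|e_le] := ltP 0 e; first by have := mulr_gt0 ep y0; lra.
  have fp : 0 < f by lra.
  by have := mulr_gt0 fp z0; lra.
apply: powR_inv_sqrt_jensen; [by apply: pos; lra..|].
(* The three permuted heights sum to [(a + b + c) * (x + y + z)], at most three times the common
   height [s * (x + y + z)]. *)
have xyz0 : 0 <= x + y + z by lra.
by have := ler_wpM2r xyz0 abc3; lra.
Qed.

Lemma rotation_mulmxT M : is_rotation M -> M *m M^T = 1%:M.
Proof. by move=> [Mo _]; exact: mulmx1C. Qed.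

Lemma rotation_row_norm M : is_rotation M ->
  M i2 ord0 ^+ 2 + M i2 i1 ^+ 2 + M i2 i2 ^+ 2 = 1.
Proof.
move=> /rotation_mulmxT /matrixP /(_ i2 i2).
by rewrite !mxE sum_ord3 !mxE eqxx /= !expr2.
Qed.

Lemma drain_timeE K M : is_rotation M -> drain_time K M =
  ((K^-1)%:E * cube_time `|M i2 ord0| `|M i2 i1| `|M i2 i2|)%E.
Proof.
move=> rM; rewrite /drain_time; congr (_ * _)%E.
have mphi : measurable_fun setT (fun t : R => phi t) by exact: measurable_powR.
have phi0 (t : R) : 0 <= phi t by exact: powR_ge0.
rewrite (integral_S_R rM mphi phi0) lowE /height.
exact: (integral_cube_norm _ _ _ mphi phi0).
Qed.

(** Applying the transpose to [M d = (0, 0, l)] shows that [d] is [l] times the third row. The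
    entries of [d] are 1 or -1 and the row has norm 1, hence [l ^+ 2 = 3]. *)
Lemma diagonal_vertical_row M : is_rotation M -> diagonal_vertical M ->
  [/\ `|M i2 ord0| = (Num.sqrt 3)^-1, `|M i2 i1| = (Num.sqrt 3)^-1
     & `|M i2 i2| = (Num.sqrt 3)^-1].
Proof.
move=> rM [d dd [Mx My]]; have n1 := rotation_row_norm rM.
set l := pz (mat_apply M d).
have dE : d = mat_apply M^T (pt3 0 0 l).
  have -> : pt3 0 0 l = mat_apply M d.
    by rewrite /l; case: (mat_apply M d) Mx My => [[x y] z]; rewrite /px /py /= => -> ->.
  by rewrite -mat_apply_mul rM.1 mat_apply1.
have [dx dy dz] : [/\ px d ^+ 2 = 1, py d ^+ 2 = 1 & pz d ^+ 2 = 1].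
  by case: dd => [[[->|->]|->]|->]; rewrite /px /py /pz /=; split; ring.
move: dx dy dz; rewrite dE mat_applyE !mxE /pt3 /px /py /pz /=.
rewrite !mulr0 !add0r !exprMn => dx dy dz.
have l3 : l ^+ 2 = 3.
  by have := mul1r (l ^+ 2); rewrite -{1}n1 !mulrDl dx dy dz => <-; ring.
have inv3 (u : R) : u ^+ 2 * l ^+ 2 = 1 -> `|u| = (Num.sqrt 3)^-1.
  rewrite l3 => u3; rewrite -sqrtr_sqr -sqrtrV//; congr Num.sqrt.
  by rewrite -[LHS](mulfK (_ : 3 != 0 :> R)) ?u3 ?mul1r// pnatr_eq0.
by split; exact: inv3.
Qed.

(** The rows are [(1, -1, 0)], [(1, 1, -2)] and [(1, 1, 1)], normalised; [u * v] is [1 / sqrt 6]. *)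
Definition diagonal_rotation : 'M[R]_3 :=
  let u := (Num.sqrt 2)^-1 in let v := (Num.sqrt 3)^-1 in
  \matrix_(i < 3, j < 3)
    (nth [::] [:: [:: u; - u; 0]; [:: u * v; u * v; - 2 * (u * v)]; [:: v; v; v]] i)`_j.

Lemma diagonal_rotationP :
  is_rotation diagonal_rotation /\ diagonal_vertical diagonal_rotation.
Proof.
rewrite /diagonal_rotation; set u := (Num.sqrt 2)^-1; set v := (Num.sqrt 3)^-1.
have u2 : u * u = 2^-1 by rewrite -expr2 exprVn sqr_sqrtr.
have v2 : v * v = 3^-1 by rewrite -expr2 exprVn sqr_sqrtr.
have uv2 : u * v * (u * v) = 6^-1 by rewrite mulrACA u2 v2 -invfM; congr (_^-1); ring.
split; last first.
  exists (pt3 1 1 1); first by left; left; left.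
  by rewrite mat_applyE !mxE /= !inordK //= /px /py /pz /=; split; ring.
split; last by rewrite det_mx33 !mxE /= !inordK //=; nra.
apply/matrixP => i j; rewrite !mxE sum_ord3 !mxE.
by elim/ord3_ind: i; elim/ord3_ind: j; rewrite ?ord3_eqE ?eqxx /= ?inordK //=; nra.
Qed.

End DrainageTime.

Theorem theorem2 (R : realType) (K : R) (hK : 0 < K) :
  let Tmin : R := 8 * Num.sqrt (Num.sqrt 3) / (5 * K)
                  * (1 + 3 * Num.sqrt 3 - 4 * Num.sqrt 2) in
  [/\ (forall M : 'M[R]_3, is_rotation M -> (Tmin%:E <= drain_time K M)%E),
      (forall M : 'M[R]_3, is_rotation M -> diagonal_vertical M ->
          drain_time K M = Tmin%:E)
    & exists M : 'M[R]_3, [/\ is_rotation M, diagonal_vertical M &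
          drain_time K M = Tmin%:E]].
Proof.
move=> Tmin.
(* The fourth root of 3 arises as the inverse square root of [1 / sqrt 3]. *)
have TminE : Tmin%:E = ((K^-1)%:E *
    cube_time (Num.sqrt 3)^-1 (Num.sqrt 3)^-1 (Num.sqrt 3)^-1)%E.
  rewrite cube_time_diag ?invr_gt0 ?sqrtr_gt0// -EFinM; congr (_%:E).
  rewrite sqrtrV ?sqrtr_ge0// invrK /Tmin.
  by field; rewrite gt_eqF.
have vertical M : is_rotation M -> diagonal_vertical M -> drain_time K M = Tmin%:E.
  move=> rM vM; rewrite TminE (drain_timeE _ rM).
  by have [-> -> ->] := diagonal_vertical_row rM vM.
split => // [M rM|].
  rewrite TminE (drain_timeE _ rM); apply: lee_wpmul2l.
    by rewrite lee_fin invr_ge0 ltW.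
  apply: cube_time_min; rewrite ?normr_ge0//.
  by rewrite !real_normK ?num_real// rotation_row_norm.
have [rM vM] := @diagonal_rotationP R.
by exists diagonal_rotation; split; [exact: rM|exact: vM|exact: vertical].
Qed.
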